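(* Suppose that for some constant $\varepsilon>0$ there is an algorithm that, given a set $S$ of $n$ elements together with binary operations $\oplus,\odot:S\times S\to S$ given by Cayley tables, counts in time $O(n^{3-\varepsilon})$ the number of distributive triples, i.e., the number of triples $(x,y,z)\in S^3$ with $x\odot(y\oplus z)=(x\odot y)\oplus(x\odot z)$. Then the Strong Zero Triangle Hypothesis is false.
   Context: Strong Zero Triangle Hypothesis: for no constant $\epsilon>0$ is there an algorithm that, given an $n$-vertex graph with integer edge weights in $\{-n,\dots,n\}$, decides in time $O(n^{3-\epsilon})$ whether it contains a triangle whose three edge weights sum to $0$. Computation is in the word-RAM model with $O(\log n)$-bit words. *)

(* Defs.v *)
From HB Require Import structures.
From mathcomp Require Import all_boot all_order all_algebra.
From mathcomp Require Import all_classical all_reals all_analysis.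
Set Implicit Arguments.
Unset Strict Implicit.
Unset Printing Implicit Defensive.
Import Order.TTheory GRing.Theory Num.Theory.
Import numFieldNormedType.Exports.

Local Open Scope classical_set_scope.
Local Open Scope nat_scope.

(** * The word RAM

    A word is a number below [2 ^ w], where [w] is the word length;
    the memory is addressed by words.  A program is a finite list of
    instructions, each of unit cost, that does not depend on the input. *)

Inductive binop : Type :=
  OAdd | OSub | OMul | ODiv | OMod | OAnd | OOr | OXor | OShl | OShr.

(* [r], [a], [b] are register names and [l] is an instruction index. *)
Inductive instr : Type :=
  | Halt
  | Const (r : nat) (k : nat)
  | Op (o : binop) (r a b : nat)
  | Read (r a : nat)
  | Write (a r : nat)
  | Jump (l : nat)
  | JumpEq (a b : nat) (l : nat)
  | JumpLt (a b : nat) (l : nat).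

Definition program : Type := seq instr.

Record state : Type := State {
  pc : nat;
  reg : nat -> nat;
  memory : nat -> nat
}.

(* All results are reduced modulo [2 ^ w].  As for [%/] and [%%], division by
   zero gives [0] and [a] modulo zero is [a]. *)
Definition eval_binop (w : nat) (o : binop) (a b : nat) : nat :=
  match o with
  | OAdd => a + b
  | OSub => (a + 2 ^ w) - b
  | OMul => a * b
  | ODiv => a %/ b
  | OMod => a %% b
  | OAnd => Nat.land a b
  | OOr => Nat.lor a b
  | OXor => Nat.lxor a b
  | OShl => a * 2 ^ b
  | OShr => a %/ 2 ^ b
  end %% 2 ^ w.

(* A program counter outside the program also means that the machine halted. *)
Definition current (p : program) (s : state) : instr := nth Halt p (pc s).

Definition step (w : nat) (p : program) (s : state) : state :=
  let: State i r m := s in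
  match current p s with
  | Halt => s
  | Const x k => State i.+1 [eta r with x |-> k %% 2 ^ w] m
  | Op o x a b =>
      State i.+1 [eta r with x |-> eval_binop w o (r a) (r b)] m
  | Read x a => State i.+1 [eta r with x |-> m (r a)] m
  | Write a x => State i.+1 r [eta m with r a |-> r x]
  | Jump l => State l r m
  | JumpEq a b l => State (if r a == r b then l else i.+1) r m
  | JumpLt a b l => State (if r a < r b then l else i.+1) r m
  end.

Definition init (input : seq nat) : state :=
  State 0 (fun=> 0) (fun i => nth 0 input i).

(* A halted state is a fixpoint of [step], so [t] bounds the running time. *)
Definition computes_within
    (w : nat) (p : program) (input : seq nat) (t out : nat) : Prop :=
  let s := iter t (step w p) (init input) in
  current p s = Halt /\ reg s 0 = out.

Definition fits (w : nat) (input : seq nat) : Prop :=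
  size input <= 2 ^ w /\ {in input, forall x, x < 2 ^ w}.

(** * Problems and running times *)

Record problem : Type := Problem {
  instance : nat -> Type;
  encode : forall n : nat, instance n -> seq nat;
  answer : forall n : nat, instance n -> nat
}.

(* The word length on instances of size [n] is [c * ceil (log2 (n + 2))]. *)
Definition word_length (c n : nat) : nat := c * up_log 2 n.+2.

Definition solves_in_time
    (pb : problem) (c : nat) (p : program) (T : nat -> nat) : Prop :=
  forall (n : nat) (I : instance pb n),
    fits (word_length c n) (encode I) /\
    computes_within (word_length c n) p (encode I) (T n) (answer I).

Definition solvable_in_time_O
    (R : realType) (pb : problem) (f : nat -> R) : Prop :=
  exists (c : nat) (p : program) (T : nat -> nat),
    solves_in_time pb c p T /\
    ((fun n => (T n)%:R%R : R) =O_\oo f)%R.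

(** * Counting distributive triples *)

Record two_ops (n : nat) : Type := TwoOps {
  oplus : 'I_n -> 'I_n -> 'I_n;
  odot : 'I_n -> 'I_n -> 'I_n
}.

Definition distributive_triples (n : nat) (S : two_ops n) :
    {set 'I_n * 'I_n * 'I_n} :=
  [set t | let: (x, y, z) := t in
     odot S x (oplus S y z) == oplus S (odot S x y) (odot S x z)].

Definition cayley_table (n : nat) (op : 'I_n -> 'I_n -> 'I_n) : seq nat :=
  [seq val (op x y) | x <- enum 'I_n, y <- enum 'I_n].

Definition counting_distributive_triples : problem :=
  @Problem two_ops
    (fun n S => n :: cayley_table (oplus S) ++ cayley_table (odot S))
    (fun n S => #|distributive_triples S|).

(** * Zero Triangle *)

(* Weights are only meaningful on edges. *)
Record weighted_graph (n : nat) : Type := WeightedGraph {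
  edge : rel 'I_n;
  weight : 'I_n -> 'I_n -> int;
  edge_sym : symmetric edge;
  edge_irrefl : irreflexive edge;
  weight_sym : forall u v, edge u v -> weight u v = weight v u;
  weight_bound : forall u v, edge u v -> (- n%:Z <= weight u v <= n%:Z)%R
}.

Definition has_zero_triangle (n : nat) (G : weighted_graph n) : bool :=
  [exists u, exists v, exists x,
     [&& edge G u v, edge G v x, edge G u x &
         (weight G u v + weight G v x + weight G u x == 0)%R]].

(* Adjacency matrix: [0] for a non-edge, [weight + n + 1 >= 1] for an edge. *)
Definition adjacency_matrix (n : nat) (G : weighted_graph n) : seq nat :=
  [seq (if edge G u v then `|(weight G u v + n.+1%:Z)%R|%N else 0)
     | u <- enum 'I_n, v <- enum 'I_n].

Definition zero_triangle : problem :=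
  @Problem weighted_graph
    (fun n G => n :: adjacency_matrix G)
    (fun n G => nat_of_bool (has_zero_triangle G)).

Definition strong_zero_triangle_hypothesis (R : realType) : Prop :=
  forall eps : R, (0 < eps)%R ->
    ~ solvable_in_time_O zero_triangle (fun n => (n%:R `^ (3 - eps))%R).

(* Main.v *)
(* A triangle with a matrix entry w + n + 1 on every edge is a zero triangle iff
   its three entries add up to 3n + 3; giving the non-edges an entry 3n + 4
   excludes all other triples.  Take three copies X, Y, Z of the vertices, padded
   by isolated ones to L = 9n + 13 elements each, and four copies of the residues
   modulo L, and define  y + z = d(y, z),  p + q = the sum of the residues p, q,
   x . y = d(x, y),  x . z = d(x, z)  and  x . r = 3n + 3 - r, each on and into
   a copy of its own; all other values are one absorbing element.  Then a triple
   outside X * Y * Z is distributive since both sides are absorbing, and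
   (x, y, z) is distributive iff 3n + 3 - d(y, z) = d(x, y) + d(x, z).  Among
   8 L elements (most of the last copy is unused) there are thus 511 L^3
   distributive triples plus one for each zero triple.

   The word RAM program writes both tables to fresh memory, runs the given
   program on them, reducing every result modulo the power of two for its shorter
   word length, and compares the count with 511 L^3. *)
Require Import Defs.
From Stdlib Require Import PeanoNat.
From mathcomp Require Import all_boot all_order all_algebra.
From mathcomp Require Import all_classical all_reals all_analysis.
From mathcomp Require Import zify lra.
Set Implicit Arguments.
Unset Strict Implicit.
Unset Printing Implicit Defensive.
Local Open Scope nat_scope.

(** * Code fragments of the word RAM *)

(** A bound instead of an exact number of steps lets branches of different lengths share one
    estimate. *)
Definition reaches (w : nat) (P : program) (t : nat) (s s' : state) : Prop :=
  exists2 t', t' <= t & iter t' (step w P) s = s'.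

Lemma reaches_refl w P t s : reaches w P t s s.
Proof. by exists 0. Qed.

Lemma reaches_trans w P t1 t2 s1 s2 s3 :
  reaches w P t1 s1 s2 -> reaches w P t2 s2 s3 ->
  reaches w P (t1 + t2) s1 s3.
Proof.
move=> [u1 le1 <-] [u2 le2 <-]; exists (u2 + u1); last by rewrite iterD.
by rewrite addnC leq_add.
Qed.

Lemma reaches_step w P t s s' :
  reaches w P t (step w P s) s' -> reaches w P t.+1 s s'.
Proof. by move=> [u leu <-]; exists u.+1; rewrite ?iterSr. Qed.

Lemma reaches_leq w P t t' s s' :
  t <= t' -> reaches w P t s s' -> reaches w P t' s s'.
Proof. by move=> le' [u leu <-]; exists u => //; apply: leq_trans le'. Qed.

Lemma step_halted w P s : current P s = Halt -> step w P s = s.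
Proof. by case: s => i r m; rewrite /step => ->. Qed.

Lemma iter_step_halted w P t s :
  current P s = Halt -> iter t (step w P) s = s.
Proof. by move=> hs; elim: t => //= t ->; apply: step_halted. Qed.

(* Jumps being absolute, the instructions depend on the address of the first
   one. *)
Definition code := nat -> program.

(** Quantifying over the code [P] before and [Q] after makes a fragment valid at every address;
    control leaves it through its end, so fragments can be chained. *)
Definition goes (w : nat) (c : code) (t : nat)
    (r m r' m' : nat -> nat) : Prop :=
  forall P Q : program,
    reaches w (P ++ c (size P) ++ Q) t (State (size P) r m)
      (State (size P + size (c (size P))) r' m').

Definition seqc (c1 c2 : code) : code :=
  fun b => c1 b ++ c2 (b + size (c1 b)).

Notation "c1 ;; c2" := (seqc c1 c2) (at level 60, right associativity).

Lemma goes_seqc w c1 c2 t1 t2 r1 m1 r2 m2 r3 m3 :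
  goes w c1 t1 r1 m1 r2 m2 -> goes w c2 t2 r2 m2 r3 m3 ->
  goes w (c1 ;; c2) (t1 + t2) r1 m1 r3 m3.
Proof.
move=> h1 h2 P Q; rewrite /seqc size_cat addnA -catA.
have := h1 P (c2 (size P + size (c1 (size P))) ++ Q) => /reaches_trans; apply.
by have := h2 (P ++ c1 (size P)) Q; rewrite size_cat -!catA.
Qed.

Lemma nth_code (P B Q : program) k :
  k < size B -> nth Halt (P ++ B ++ Q) (size P + k) = nth Halt B k.
Proof. by move=> ltk; rewrite !nth_cat ltnNge leq_addr /= addKn ltk. Qed.

Lemma goes_instr w i r m r' m' :
  (forall P b, nth Halt P b = i ->
     step w P (State b r m) = State b.+1 r' m') ->
  goes w (fun=> [:: i]) 1 r m r' m'.
Proof.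
move=> hi P Q; apply: reaches_step; rewrite hi ?addn1.
  exact: reaches_refl.
by rewrite -[size P]addn0 nth_code.
Qed.

(* Variables live in the even registers, temporaries in the odd ones. *)
Definition var (x : nat) := x.*2.
Definition temp (d : nat) := d.*2.+1.

Definition holds (r e : nat -> nat) : Prop := forall x, r (var x) = e x.

(** * Expressions and their compilation *)

Inductive expr : Type :=
  | Var (x : nat)
  | Num (k : nat)
  | Bin (o : binop) (a b : expr)
  | Deref (a : expr)
  | If (lt : bool) (a b x y : expr).

Definition compare (lt : bool) (a b : nat) : bool :=
  if lt then a < b else a == b.

(** A variable is fetched by OR-ing its register with itself, which truncates to [w] bits, whereas a
    memory read does not truncate; hence only [Var] is reduced. *)
Fixpoint eval (w : nat) (e m : nat -> nat) (x : expr) : nat :=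
  match x with
  | Var v => e v %% 2 ^ w
  | Num k => k %% 2 ^ w
  | Bin o a b => eval_binop w o (eval w e m a) (eval w e m b)
  | Deref a => m (eval w e m a)
  | If lt a b x y =>
      if compare lt (eval w e m a) (eval w e m b)
      then eval w e m x else eval w e m y
  end.

Definition jump (lt : bool) (a b l : nat) : instr :=
  if lt then JumpLt a b l else JumpEq a b l.

Lemma step_jump w P lt a b l i r m :
  nth Halt P i = jump lt a b l ->
  step w P (State i r m) =
    State (if compare lt (r a) (r b) then l else i.+1) r m.
Proof. by rewrite /step /current /= => ->; case: lt. Qed.

(** The code for a failed test comes first, where the conditional jump falls through; [q] lies
    behind that jump, [C2] and the jump over [C1]. *)
Definition branch (lt : bool) (a b : nat) (c1 c2 : code) : code := fun p =>
  let C2 := c2 p.+1 in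
  let q := (p + size C2).+2 in
  let C1 := c1 q in
  jump lt a b q :: C2 ++ Jump (q + size C1) :: C1.

Lemma goes_branch w lt a b c1 c2 t1 t2 r m r' m' :
  (if compare lt (r a) (r b)
   then goes w c1 t1 r m r' m' else goes w c2 t2 r m r' m') ->
  goes w (branch lt a b c1 c2) (t1 + t2).+2 r m r' m'.
Proof.
move=> h P Q; rewrite /branch.
set C2 := c2 _; set q := (_ + _).+2; set C1 := c1 q.
set B := _ :: _; set R := P ++ B ++ Q.
have at0 : nth Halt R (size P) = jump lt a b q.
  by rewrite -[size P]addn0 nth_code.
have sB : size B = (size C2 + size C1).+2 by rewrite /= size_cat /= addnS.
apply: reaches_step; rewrite (step_jump _ _ _ at0).
case: ifP h => _ h.
  have := h (P ++ jump lt a b q :: C2 ++ [:: Jump (q + size C1)]) Q.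
  have -> : size (P ++ jump lt a b q :: C2 ++ [:: Jump (q + size C1)]) = q.
    by rewrite size_cat /= size_cat /= /q; lia.
  have -> :
      (P ++ jump lt a b q :: C2 ++ [:: Jump (q + size C1)]) ++ C1 ++ Q = R.
    by rewrite /R /B /= -!catA /= -!catA.
  move=> h'; have -> : size P + size B = q + size C1 by rewrite sB /q; lia.
  by apply: reaches_leq h'; lia.
have := h (P ++ [:: jump lt a b q]) (Jump (q + size C1) :: C1 ++ Q).
rewrite size_cat /= addn1 -/C2 -!catA /=.
have -> : P ++ jump lt a b q :: C2 ++ Jump (q + size C1) :: C1 ++ Q = R.
  by rewrite /R /B /= -!catA.
move=> h'; have -> : (t1 + t2).+1 = t2 + t1.+1 by lia.
apply: reaches_trans h' _; apply: reaches_step.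
have atj : nth Halt R ((size P).+1 + size C2) = Jump (q + size C1).
  rewrite addSnnS nth_code ?sB; last by lia.
  by rewrite /B /= nth_cat ltnn subnn.
rewrite /step /current /= atj.
have -> : size P + size B = q + size C1 by rewrite sB /q; lia.
exact: reaches_refl.
Qed.

(** Temporaries act as a stack: the value goes to [temp d] and none below [d] is touched, so a left
    operand survives the evaluation of the right one. *)
Fixpoint compile (d : nat) (x : expr) : code :=
  match x with
  | Var v => fun=> [:: Op OOr (temp d) (var v) (var v)]
  | Num k => fun=> [:: Const (temp d) k]
  | Bin o a b =>
      compile d a ;; compile d.+1 b ;;
      (fun=> [:: Op o (temp d) (temp d) (temp d.+1)])
  | Deref a => compile d a ;; (fun=> [:: Read (temp d) (temp d)])
  | If lt a b x y =>
      compile d a ;; compile d.+1 b ;;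
      branch lt (temp d) (temp d.+1) (compile d x) (compile d y)
  end.

Fixpoint cost (x : expr) : nat :=
  match x with
  | Var _ | Num _ => 1
  | Bin _ a b => cost a + (cost b + 1)
  | Deref a => cost a + 1
  | If _ a b x y => cost a + (cost b + (cost x + cost y).+2)
  end.

Lemma var_temp x d : (var x == temp d) = false.
Proof. by apply/negbTE/eqP; rewrite /var /temp; lia. Qed.

Lemma temp_inj d d' : (temp d == temp d') = (d == d').
Proof. by apply/eqP/eqP; rewrite /temp; lia. Qed.

Lemma var_inj d d' : (var d == var d') = (d == d').
Proof. by apply/eqP/eqP; rewrite /var; lia. Qed.

Lemma goes_compile w x d e m r :
  holds r e -> exists r',
    [/\ goes w (compile d x) (cost x) r m r' m, holds r' e,
        (forall k, k < d -> r' (temp k) = r (temp k)) &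
        r' (temp d) = eval w e m x].
Proof.
elim: x d r => [v|k|o a iha b ihb|a iha|lt a iha b ihb x ihx y ihy] d r re /=.
- eexists; split.
  + by apply: goes_instr => P i hP; rewrite /step /current /= hP.
  + by move=> x /=; rewrite var_temp.
  + by move=> k ltkd /=; rewrite temp_inj ltn_eqF.
  + by rewrite /= eqxx /eval_binop re Nat.lor_diag.
- eexists; split.
  + by apply: goes_instr => P i hP; rewrite /step /current /= hP.
  + by move=> x /=; rewrite var_temp.
  + by move=> j ltkd /=; rewrite temp_inj ltn_eqF.
  + by rewrite /= eqxx.
- have [r1 [g1 re1 k1 v1]] := iha d r re.
  have [r2 [g2 re2 k2 v2]] := ihb d.+1 r1 re1.
  eexists; split.
  + apply: goes_seqc g1 _; apply: goes_seqc g2 _.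
    by apply: goes_instr => P i hP; rewrite /step /current /= hP.
  + by move=> x /=; rewrite var_temp.
  + move=> k ltkd /=; rewrite temp_inj ltn_eqF // k2 ?k1 //; exact: ltnW.
  + by rewrite /= eqxx k2 // v1 v2.
- have [r1 [g1 re1 k1 v1]] := iha d r re.
  eexists; split.
  + apply: goes_seqc g1 _.
    by apply: goes_instr => P i hP; rewrite /step /current /= hP.
  + by move=> x /=; rewrite var_temp.
  + by move=> k ltkd /=; rewrite temp_inj ltn_eqF // k1.
  + by rewrite /= eqxx v1.
- have [r1 [g1 re1 k1 v1]] := iha d r re.
  have [r2 [g2 re2 k2 v2]] := ihb d.+1 r1 re1.
  have v1' : r2 (temp d) = eval w e m a by rewrite k2.
  have [r3 [g3 re3 k3 v3]] : exists r3,
      [/\ goes w (branch lt (temp d) (temp d.+1) (compile d x) (compile d y))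
            (cost x + cost y).+2 r2 m r3 m, holds r3 e,
          (forall k, k < d -> r3 (temp k) = r2 (temp k)) &
          r3 (temp d) = if compare lt (eval w e m a) (eval w e m b)
                        then eval w e m x else eval w e m y].
    rewrite -v1' -v2; case: ifP => hc.
      have [r3 [g3 ? ? ?]] := ihx d r2 re2.
      by exists r3; split => //; apply: goes_branch; rewrite hc.
    have [r3 [g3 ? ? ?]] := ihy d r2 re2.
    by exists r3; split => //; apply: goes_branch; rewrite hc.
  exists r3; split => //; first exact: goes_seqc g1 (goes_seqc g2 g3).
  by move=> k ltkd; rewrite k3 // k2 ?k1 //; apply: ltnW.
Qed.

(** Only the even registers are described on both sides, so commands compose without tracking
    scratch values. *)
Definition runs (w : nat) (c : code) (t : nat) (e m e' m' : nat -> nat) :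
    Prop :=
  forall r, holds r e -> exists2 r', holds r' e' & goes w c t r m r' m'.

Lemma runs_seqc w c1 c2 t1 t2 e1 m1 e2 m2 e3 m3 :
  runs w c1 t1 e1 m1 e2 m2 -> runs w c2 t2 e2 m2 e3 m3 ->
  runs w (c1 ;; c2) (t1 + t2) e1 m1 e3 m3.
Proof.
move=> h1 h2 r /h1[r1 /h2[r2 he g2] g1].
by exists r2 => //; apply: goes_seqc g1 g2.
Qed.

Lemma runs_leq w c t t' e m e' m' :
  t <= t' -> runs w c t e m e' m' -> runs w c t' e m e' m'.
Proof.
move=> le h r /h[r' he g]; exists r' => // P Q.
exact: reaches_leq le (g P Q).
Qed.

(** * Assignments, stores and loops *)

Definition assign (v : nat) (x : expr) : code :=
  compile 0 x ;; (fun=> [:: Op OOr (var v) (temp 0) (temp 0)]).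

Lemma runs_assign w v x y e m :
  eval w e m x = y -> y < 2 ^ w ->
  runs w (assign v x) (cost x + 1) e m [eta e with v |-> y] m.
Proof.
move=> <- lty r re; have [r1 [g1 re1 _ v1]] := goes_compile w x 0 m re.
eexists; last first.
  apply: goes_seqc g1 _.
  by apply: goes_instr => P i hP; rewrite /step /current /= hP.
move=> z; rewrite /= var_inj; case: eqP => // _.
by rewrite v1 /eval_binop Nat.lor_diag modn_small.
Qed.

Definition store (x y : expr) : code :=
  compile 0 x ;; compile 1 y ;; (fun=> [:: Write (temp 0) (temp 1)]).

Lemma runs_store w x y a v e m :
  eval w e m x = a -> eval w e m y = v ->
  runs w (store x y) (cost x + (cost y + 1)) e m e [eta m with a |-> v].
Proof.
move=> <- <- r re; have [r1 [g1 re1 _ v1]] := goes_compile w x 0 m re.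
have [r2 [g2 re2 k2 v2]] := goes_compile w y 1 m re1.
exists r2 => //; apply: goes_seqc g1 _; apply: goes_seqc g2 _.
by apply: goes_instr => P i hP; rewrite /step /current /= hP v2 k2 // v1.
Qed.

(** [q] is the address of the body, behind the test and its two jumps; the exit jump skips the body
    and the jump back to [b]. *)
Definition while_lt (x y : expr) (c : code) : code := fun b =>
  let C := (compile 0 x ;; compile 1 y) b in
  let q := (b + size C).+2 in
  C ++ [:: jump true (temp 0) (temp 1) q, Jump (q + size (c q)).+1 &
        c q ++ [:: Jump b]].

Lemma runs_while_stop w x y c e m :
  eval w e m y <= eval w e m x ->
  runs w (while_lt x y c) (cost x + cost y).+2 e m e m.
Proof.
move=> leyx r re; have [r1 [g1 re1 _ v1]] := goes_compile w x 0 m re.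
have [r2 [g2 re2 k2 v2]] := goes_compile w y 1 m re1.
exists r2 => //; have g := goes_seqc g1 g2 => P Q; rewrite /while_lt.
set C := (_ ;; _) _; set q := (_ + _).+2; set B := C ++ _.
have := g P ([:: jump true (temp 0) (temp 1) q, Jump (q + size (c q)).+1 &
        c q ++ [:: Jump (size P)]] ++ Q).
rewrite -/C.
have -> : P ++ C ++ [:: jump true (temp 0) (temp 1) q, Jump (q + size (c q)).+1
        & c q ++ [:: Jump (size P)]] ++ Q = P ++ B ++ Q.
  by rewrite /B -catA.
have sB : size B = size C + (size (c q) + 3).
  by rewrite /B size_cat /= size_cat /=; lia.
have at1 : nth Halt (P ++ B ++ Q) (size P + size C).+1 =
    Jump (q + size (c q)).+1.
  rewrite -addnS nth_code; last by rewrite sB; lia.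
  by rewrite /B nth_cat ltnNge leqnSn /= subSnn.
move=> g'; rewrite -addn2; apply: reaches_trans g' _.
apply: reaches_step; rewrite (@step_jump _ _ true (temp 0) (temp 1) q).
  rewrite /compare v2 k2 // v1 ltnNge leyx /=; apply: reaches_step.
  rewrite /step /current /= at1.
  have -> : size P + size B = (q + size (c q)).+1 by rewrite sB /q; lia.
  exact: reaches_refl.
rewrite nth_code; last by rewrite sB; lia.
by rewrite /B nth_cat ltnn subnn.
Qed.

Lemma runs_while_next w x y c t t' e m e1 m1 e2 m2 :
  eval w e m x < eval w e m y ->
  runs w c t e m e1 m1 ->
  runs w (while_lt x y c) t' e1 m1 e2 m2 ->
  runs w (while_lt x y c) ((cost x + cost y).+2 + t + t') e m e2 m2.
Proof.
move=> ltxy hc hw r re; have [r1 [g1 re1 _ v1]] := goes_compile w x 0 m re.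
have [r2 [g2 re2 k2 v2]] := goes_compile w y 1 m re1.
have [r3 re3 g3] := hc r2 re2; have [r4 re4 g4] := hw r3 re3.
exists r4 => //; have g := goes_seqc g1 g2 => P Q; move: (g4 P Q).
rewrite /while_lt.
set C := (_ ;; _) _; set q := (_ + _).+2; set B := C ++ _ => g4'.
apply: reaches_trans g4'.
have := g P ([:: jump true (temp 0) (temp 1) q, Jump (q + size (c q)).+1 &
        c q ++ [:: Jump (size P)]] ++ Q).
rewrite -/C.
have -> : P ++ C ++ [:: jump true (temp 0) (temp 1) q, Jump (q + size (c q)).+1
        & c q ++ [:: Jump (size P)]] ++ Q = P ++ B ++ Q.
  by rewrite /B -catA.
have sB : size B = size C + (size (c q) + 3).
  by rewrite /B size_cat /= size_cat /=; lia.
move=> g'; have -> : (cost x + cost y).+2 + t = cost x + cost y + (t + 1).+1.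
  by lia.
apply: reaches_trans g' _.
apply: reaches_step; rewrite (@step_jump _ _ true (temp 0) (temp 1) q).
  rewrite /compare v2 k2 // v1 ltxy.
  have := g3 (P ++ C ++ [:: jump true (temp 0) (temp 1) q;
    Jump (q + size (c q)).+1]) ([:: Jump (size P)] ++ Q).
  rewrite size_cat size_cat [size [:: _; _]]/= addn2 !addnS -/q.
  have -> : (P ++ C ++ [:: jump true (temp 0) (temp 1) q;
      Jump (q + size (c q)).+1]) ++ c q ++ [:: Jump (size P)] ++ Q =
      P ++ B ++ Q.
    by rewrite /B -!catA /= -!catA.
  rewrite -addnS => g3'; apply: reaches_trans g3' _; apply: reaches_step.
  have at1 : nth Halt (P ++ B ++ Q) (q + size (c q)) = Jump (size P).
    have -> : q + size (c q) = size P + (size C + (size (c q)).+2).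
      by rewrite /q; lia.
    rewrite nth_code; last by rewrite sB; lia.
    by rewrite /B nth_cat ltnNge leq_addr /= addKn /= nth_cat ltnn subnn.
  rewrite /step /current /= at1.
  exact: reaches_refl.
rewrite nth_code; last by rewrite sB; lia.
by rewrite /B nth_cat ltnn subnn.
Qed.

(** The families [e] and [m] act as loop invariant; induction on [K] peels off the first round and
    shifts both families. *)
Lemma runs_while w x y c t (K : nat) (e m : nat -> nat -> nat) :
  (forall k, k < K -> eval w (e k) (m k) x < eval w (e k) (m k) y) ->
  eval w (e K) (m K) y <= eval w (e K) (m K) x ->
  (forall k, k < K -> runs w c t (e k) (m k) (e k.+1) (m k.+1)) ->
  runs w (while_lt x y c)
    (K * ((cost x + cost y).+2 + t) + (cost x + cost y).+2) (e 0) (m 0) (e K) (m K).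
Proof.
elim: K e m => [|K ih] e m lt_xy le_yx hc; first exact: runs_while_stop.
rewrite mulSn -addnA; apply: runs_while_next (lt_xy 0 _) (hc 0 _) _ => //.
by apply: (ih (fun k => e k.+1) (fun k => m k.+1)) => // k ltk;
  [apply: lt_xy | apply: hc].
Qed.

(** * Simulating a program with a shorter word length *)

Arguments var : simpl never.
Arguments temp : simpl never.

Definition own (x : nat) := var (x + 8).
Definition size_var : nat := 5.

(* Every instruction is simulated by three, which makes the jump targets
   computable. *)
Definition target (p : program) (b l : nat) : nat := b + 3 * minn l (size p).

Arguments own : simpl never.
Arguments target : simpl never.

(** Results are cut down by a remainder modulo [M] and addresses are shifted by [M]. As targets are
    capped, halting and leaving [p] both lead to the first instruction behind the simulation. *)
Definition simulate_instr (p : program) (b i : nat) : program :=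
  let M := var size_var in
  let t := temp 0 in
  match nth Halt p i with
  | Halt => [:: Jump (target p b (size p))]
  | Const x k =>
      [:: Const (own x) k; Op OMod (own x) (own x) M; Jump (target p b i.+1)]
  | Op o x y z =>
      [:: Op o (own x) (own y) (own z); Op OMod (own x) (own x) M;
          Jump (target p b i.+1)]
  | Read x a =>
      [:: Op OAdd t (own a) M; Read (own x) t; Jump (target p b i.+1)]
  | Write a x =>
      [:: Op OAdd t (own a) M; Write t (own x); Jump (target p b i.+1)]
  | Jump l => [:: Jump (target p b l)]
  | JumpEq x y l =>
      [:: JumpEq (own x) (own y) (target p b l); Jump (target p b i.+1)]
  | JumpLt x y l =>
      [:: JumpLt (own x) (own y) (target p b l); Jump (target p b i.+1)]
  end.

Definition simulate (p : program) : code := fun b =>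
  mkseq (fun k => nth Halt (simulate_instr p b (k %/ 3)) (k %% 3)) (3 * size p).

Lemma nth_simulate p b i j : i < size p -> j < 3 ->
  nth Halt (simulate p b) (3 * i + j) = nth Halt (simulate_instr p b i) j.
Proof.
move=> lti ltj; rewrite nth_mkseq; last by lia.
by rewrite mulnC divnMDl // divn_small // addn0 modnMDl modn_small.
Qed.

(** Before reduction all operations but subtraction give the same number at both word lengths, and
    [2 ^ v] divides [2 ^ w]; the two offsets in subtraction differ by a multiple of [2 ^ v]. *)
Lemma eval_binop_mod v w o a b :
  v <= w -> a < 2 ^ v -> b < 2 ^ v ->
  eval_binop w o a b %% 2 ^ v = eval_binop v o a b.
Proof.
move=> levw lta ltb.
have dv : 2 ^ v %| 2 ^ w by rewrite dvdn_exp2l.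
have dle : 2 ^ v <= 2 ^ w by rewrite leq_exp2l.
case: o; rewrite /eval_binop modn_dvdm //.
have -> : a + 2 ^ w - b = a + 2 ^ v - b + (2 ^ w - 2 ^ v) by lia.
by rewrite -modnDmr (eqP (dvdn_sub dv (dvdnn _))) addn0.
Qed.

Definition bounded (w : nat) (s : state) : Prop :=
  (forall x, reg s x < 2 ^ w) /\ (forall a, memory s a < 2 ^ w).

Lemma bounded_init w input : fits w input -> bounded w (init input).
Proof.
case=> _ h; split=> x /=; first by rewrite expn_gt0.
have [ltx|lex] := ltnP x (size input); first by rewrite h ?mem_nth.
by rewrite nth_default // expn_gt0.
Qed.

Lemma bounded_step w p s : bounded w s -> bounded w (step w p s).
Proof.
have gt0 : 0 < 2 ^ w by rewrite expn_gt0.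
case: s => i r m [hr hm]; rewrite /step.
case: (current _ _) => [|x k|o x a b|x a|a x|l|a b l|a b l]; split=> //= y;
  case: eqP => // _; rewrite ?ltn_pmod //; case: o; rewrite /= ltn_pmod //.
Qed.

(* The simulated memory starts at the address [2 ^ v], which is kept in the
   variable [size_var]. *)
Definition simulated (p : program) (v b : nat) (s s' : state) : Prop :=
  [/\ pc s' = target p b (pc s),
      (forall x, reg s' (own x) = reg s x),
      reg s' (var size_var) = 2 ^ v &
      forall a, a < 2 ^ v -> memory s' (2 ^ v + a) = memory s a].

Lemma own_inj x y : (own x == own y) = (x == y).
Proof. by apply/eqP/eqP; rewrite /own /var; lia. Qed.

Lemma own_temp x d : (own x == temp d) = false.
Proof. by apply/negbTE/eqP; rewrite /own /temp /var; lia. Qed.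

Lemma own_var x y : y < 8 -> (own x == var y) = false.
Proof. by move=> ?; apply/negbTE/eqP; rewrite /own /var; lia. Qed.

Lemma var_own x y : y < 8 -> (var y == own x) = false.
Proof. by rewrite eq_sym; apply: own_var. Qed.

(** The surrounding program uses its variables after the simulation, namely [side n] in the final
    comparison. *)
Definition keeps (s s' : state) : Prop :=
  forall x, x < 8 -> reg s' (var x) = reg s (var x).

(** Boundedness makes all operands short words, and [v < w] leaves a spare bit, so that the shifted
    addresses [2 ^ v + a] do not wrap around. *)
Lemma simulate_step w v p (P Q : program) s s' :
  v < w -> bounded v s -> simulated p v (size P) s s' -> current p s <> Halt ->
  exists s'', [/\ reaches w (P ++ simulate p (size P) ++ Q) 3 s' s'',
                  simulated p v (size P) (step v p s) s'' & keeps s' s''].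
Proof.
set b := size P; set R := P ++ _.
case: s => i r m; case: s' => i' r' m' ltvw [/= hr hm] [/= -> er eM em] hi.
have lt2 : 2 ^ v < 2 ^ w by rewrite ltn_exp2l.
have le2 : 2 * 2 ^ v <= 2 ^ w by rewrite -expnS leq_exp2l.
have lti : i < size p.
  by rewrite ltnNge; apply/negP => lei; apply: hi; rewrite /current nth_default.
have atR j : j < 3 -> nth Halt R (target p b i + j) =
    nth Halt (simulate_instr p b i) j.
  move=> ltj; rewrite /target (minn_idPl (ltnW lti)) -addnA nth_code.
    exact: nth_simulate.
  by rewrite size_mkseq; lia.
have at0 := atR 0 isT; have at1 := atR 1 isT; have at2 := atR 2 isT.
rewrite addn0 in at0; rewrite addn1 in at1; rewrite addn2 in at2.
have modM a : eval_binop w OMod a (2 ^ v) = a %% 2 ^ v.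
  by rewrite /eval_binop modn_small // (ltn_trans _ lt2) // ltn_pmod ?expn_gt0.
have addM a : eval_binop w OAdd (r a) (2 ^ v) = 2 ^ v + r a.
  by rewrite /eval_binop addnC modn_small //; have := hr a; lia.
have regE := (eqxx, own_inj, own_temp, var_temp, @var_own _ size_var isT).
move: at0 at1 at2; rewrite /simulate_instr.
case ep: (nth Halt p i) => [|x k|o x y z|x a|a x|l|x y l|x y l] /= at0 at1 at2.
- by case: hi.
- eexists; split.
  + apply: reaches_step; rewrite /step /current /= at0.
    apply: reaches_step; rewrite /step /current /= at1.
    apply: reaches_step; rewrite /step /current /= at2.
    exact: reaches_refl.
  + rewrite /step /current /= ep; split => [//|z||//];
      rewrite /= !regE // eM modM.
    case: eqP => [_|//]; by rewrite modn_dvdm // dvdn_exp2l // ltnW.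
  + by move=> z ltz /=; rewrite var_own.
- eexists; split.
  + apply: reaches_step; rewrite /step /current /= at0.
    apply: reaches_step; rewrite /step /current /= at1.
    apply: reaches_step; rewrite /step /current /= at2.
    exact: reaches_refl.
  + rewrite /step /current /= ep; split => [//|u||//];
      rewrite /= !regE // eM modM.
    by case: eqP => [_|//]; rewrite !er eval_binop_mod // ltnW.
  + by move=> u ltu /=; rewrite var_own.
- eexists; split.
  + apply: reaches_step; rewrite /step /current /= at0.
    apply: reaches_step; rewrite /step /current /= at1.
    apply: reaches_step; rewrite /step /current /= at2.
    exact: reaches_refl.
  + rewrite /step /current /= ep; split => [//|u||//]; rewrite /= !regE //.
    by case: eqP => [_|_]; rewrite ?regE // er eM addM em.
  + by move=> u ltu /=; rewrite var_own // var_temp.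
- eexists; split.
  + apply: reaches_step; rewrite /step /current /= at0.
    apply: reaches_step; rewrite /step /current /= at1.
    apply: reaches_step; rewrite /step /current /= at2.
    exact: reaches_refl.
  + rewrite /step /current /= ep; split => [//|u||c ltc] /=; rewrite ?regE //.
    by rewrite !er eM addM eqn_add2l em.
  + by move=> u ltu /=; rewrite var_temp.
- eexists; split.
  + apply: reaches_step; rewrite /step /current /= at0.
    exact: reaches_refl.
  + by rewrite /step /current /= ep; split.
  + by [].
- exists (State (target p b (if r x == r y then l else i.+1)) r' m'); split.
  + apply: reaches_step; rewrite /step /current /= at0 !er.
    case: ifP => _; first exact: reaches_refl.
    apply: reaches_step; rewrite /step /current /= at1; exact: reaches_refl.
  + by rewrite /step /current /= ep; split.
  + by [].
- exists (State (target p b (if r x < r y then l else i.+1)) r' m'); split.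
  + apply: reaches_step; rewrite /step /current /= at0 !er.
    case: ifP => _; first exact: reaches_refl.
    apply: reaches_step; rewrite /step /current /= at1; exact: reaches_refl.
  + by rewrite /step /current /= ep; split.
  + by [].
Qed.

Lemma simulate_iter w v p (P Q : program) t s s' :
  v < w -> bounded v s -> simulated p v (size P) s s' ->
  exists s'', [/\ reaches w (P ++ simulate p (size P) ++ Q) (3 * t) s' s'',
     simulated p v (size P) (iter t (step v p) s) s'' & keeps s' s''].
Proof.
move=> ltvw; elim: t s s' => [|t ih] s s' hb hs.
  by exists s'; split=> //; exact: reaches_refl.
have [hc|hc] := pselect (current p s = Halt).
  exists s'; split=> //; first exact: reaches_refl.
  by rewrite iter_step_halted.
have [s1 [r1 h1 k1]] := simulate_step Q ltvw hb hs hc.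
have [s2 [r2 h2 k2]] := ih _ _ (bounded_step p hb) h1.
exists s2; split; first by rewrite mulnS; apply: reaches_trans r1 r2.
  by rewrite iterSr.
by move=> x ltx; rewrite k2 ?k1.
Qed.

Lemma reaches_simulate w v p input t out (P Q : program) r m :
  v < w -> fits v input -> computes_within v p input t out ->
  r (var size_var) = 2 ^ v -> (forall x, r (own x) = 0) ->
  (forall a, a < 2 ^ v -> m (2 ^ v + a) = nth 0 input a) ->
  exists r' m', [/\ r' (own 0) = out,
    forall x, x < 8 -> r' (var x) = r (var x) &
    reaches w (P ++ simulate p (size P) ++ Q) (3 * t).+1 (State (size P) r m)
      (State (size P + size (simulate p (size P))) r' m')].
Proof.
move=> ltvw fit [/= halted outE] eM er em.
have [|[i r' m'] [h [/= iE er' _ _] k]] :=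
  @simulate_iter w v p P Q t (init input) (State (size P) r m) ltvw
    (bounded_init fit).
  by split=> //=; rewrite /target min0n muln0 addn0.
exists r', m'; split=> //; first by rewrite er' outE.
rewrite -addn1; apply: reaches_trans h _; rewrite iE size_mkseq.
set s := iter _ _ _ in halted outE iE er' *.
(* A program counter beyond [p] is already mapped to the end of the simulation; a genuine [Halt]
   takes one more jump, which is the extra step of the bound. *)
have [lei|lti] := leqP (size p) (pc s).
  rewrite /target (minn_idPr lei); exact: reaches_refl.
apply: reaches_step; rewrite /step /current /= /target (minn_idPl (ltnW lti)).
rewrite -[3 * _]addn0 nth_code; last by rewrite size_mkseq; lia.
rewrite nth_simulate // /simulate_instr [nth Halt p _]halted /= /target minnn.
exact: reaches_refl.
Qed.

(** * The reduction *)

(* Three padded entries add up to less than [side n], so that sums of entries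
   can be compared modulo [side n]. *)
Definition side (n : nat) : nat := 9 * n + 13.

(** Cell 0 holds [n], hence the offset 1 into the matrix. The filler [3 * n + 4] alone exceeds the
    required sum [3 * n + 3]. *)
Definition padded (n : nat) (a : nat -> nat) (u v : nat) : nat :=
  if u < n then
    if v < n then
      if 0 < a (u * n + v).+1 then a (u * n + v).+1 else 3 * n + 4
    else 3 * n + 4
  else 3 * n + 4.

(* The element [i] has the type [i %/ side n], between 0 and 7, and the value
   [i %% side n]; the types of both operands are read off together in octal. *)
Definition types (n i j : nat) : nat := i %/ side n * 8 + j %/ side n.

(** In octal, 10 is 12, the types of [Y] and [Z], and 37 is 45, the types of the products [x . y]
    and [x . z]. The absorbing element is [7 * L]. *)
Definition plus_entry (n : nat) (a : nat -> nat) (i j : nat) : nat :=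
  let L := side n in
  if types n i j == 10 then 3 * L + padded n a (i %% L) (j %% L)
  else if types n i j == 37 then 6 * L + (i %% L + j %% L) %% L
  else 7 * L.

(** The summand [L] keeps the truncated subtraction exact. *)
Definition dot_entry (n : nat) (a : nat -> nat) (i j : nat) : nat :=
  let L := side n in
  if types n i j == 1 then 4 * L + padded n a (i %% L) (j %% L)
  else if types n i j == 2 then 5 * L + padded n a (i %% L) (j %% L)
  else if types n i j == 3 then 6 * L + (3 * n + 3 + L - j %% L) %% L
  else 7 * L.

Definition small (n : nat) (a : nat -> nat) : Prop :=
  forall b, a b <= (2 * n).+1.

Lemma side_gt0 n : 0 < side n. Proof. by rewrite /side addn_gt0 orbT. Qed.

Lemma padded_le n a u v : small n a -> padded n a u v <= 3 * n + 4.
Proof.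
move=> ha; rewrite /padded; do 3?case: ifP => // _.
by apply: leq_trans (ha _) _; lia.
Qed.

Lemma padded_lt n a u v : small n a -> padded n a u v < side n.
Proof.
by move=> /padded_le h; apply: leq_ltn_trans (h u v) _; rewrite /side; lia.
Qed.

Lemma divn_side n t v : v < side n -> (t * side n + v) %/ side n = t.
Proof. by move=> ltv; rewrite divnMDl ?side_gt0 // divn_small // addn0. Qed.

Lemma modn_side n t v : v < side n -> (t * side n + v) %% side n = v.
Proof. by move=> ltv; rewrite modnMDl modn_small. Qed.

Lemma typesE n i j s t : j < 8 * side n -> t < 8 ->
  (types n i j == s * 8 + t) = (i %/ side n == s) && (j %/ side n == t).
Proof.
rewrite -ltn_divLR ?side_gt0 // /types.
move: (_ %/ _) (_ %/ _) => x y *; apply/eqP/andP=> [|[/eqP-> /eqP->]] // E.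
by split; apply/eqP; lia.
Qed.

Lemma plus_entry_lt n a i j : small n a -> plus_entry n a i j < 8 * side n.
Proof.
move=> ha; rewrite /plus_entry; have := side_gt0 n.
have := padded_lt (i %% side n) (j %% side n) ha.
have := @ltn_pmod (i %% side n + j %% side n) _ (side_gt0 n).
by do 2?case: ifP => _; lia.
Qed.

Lemma dot_entry_lt n a i j : small n a -> dot_entry n a i j < 8 * side n.
Proof.
move=> ha; rewrite /dot_entry; have := side_gt0 n.
have := padded_lt (i %% side n) (j %% side n) ha.
have := @ltn_pmod (3 * n + 3 + side n - j %% side n) _ (side_gt0 n).
by do 3?case: ifP => _; lia.
Qed.

Definition reduction (n : nat) (a : nat -> nat) (ha : small n a) :
    two_ops (8 * side n) :=
  TwoOps (fun i j => Ordinal (plus_entry_lt i j ha))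
         (fun i j => Ordinal (dot_entry_lt i j ha)).

Lemma plus_entry7 n a i j : j < 8 * side n ->
  ~~ ((i %/ side n == 1) && (j %/ side n == 2)) ->
  ~~ ((i %/ side n == 4) && (j %/ side n == 5)) ->
  plus_entry n a i j = 7 * side n.
Proof.
move=> ltj; rewrite /plus_entry (@typesE _ _ _ 1 2) // (@typesE _ _ _ 4 5) //.
by move=> /negbTE-> /negbTE->.
Qed.

Lemma dot_entry7 n a i j : j < 8 * side n ->
  ~~ [&& i %/ side n == 0, 0 < j %/ side n & j %/ side n < 4] ->
  dot_entry n a i j = 7 * side n.
Proof.
move=> ltj; rewrite /dot_entry (@typesE _ _ _ 0 1) // (@typesE _ _ _ 0 2) //.
rewrite (@typesE _ _ _ 0 3) //; case: eqP => //= _.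
by case: (j %/ side n) => [|[|[|[|]]]].
Qed.

Lemma plus_entry_type n a i j : small n a -> j < 8 * side n ->
  plus_entry n a i j %/ side n =
    if (i %/ side n == 1) && (j %/ side n == 2) then 3
    else if (i %/ side n == 4) && (j %/ side n == 5) then 6 else 7.
Proof.
move=> ha ltj; rewrite /plus_entry (@typesE _ _ _ 1 2) // (@typesE _ _ _ 4 5) //.
case: ifP => _; first by rewrite divn_side // padded_lt.
case: ifP => _; first by rewrite divn_side // ltn_pmod ?side_gt0.
by rewrite mulnK ?side_gt0.
Qed.

Lemma dot_entry_type n a i j : small n a -> j < 8 * side n ->
  dot_entry n a i j %/ side n =
    if [&& i %/ side n == 0, 0 < j %/ side n & j %/ side n < 4]
    then 3 + j %/ side n else 7.
Proof.
move=> ha ltj; case: ifPn => [/and3P[/eqP i0 j0 j4]|h]; last first.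
  by rewrite dot_entry7 // mulnK ?side_gt0.
rewrite /dot_entry (@typesE _ _ _ 0 1) // (@typesE _ _ _ 0 2) //.
rewrite (@typesE _ _ _ 0 3) // i0 eqxx /=.
case: (j %/ side n) j0 j4 => [|[|[|[|]]]] //= _ _.
- by rewrite divn_side // padded_lt.
- by rewrite divn_side // padded_lt.
- by rewrite divn_side // ltn_pmod ?side_gt0.
Qed.

(** * Which triples are distributive, and how many *)

Definition distributes (n : nat) (a : nat -> nat) (x y z : nat) : bool :=
  dot_entry n a x (plus_entry n a y z) ==
  plus_entry n a (dot_entry n a x y) (dot_entry n a x z).

(** Products have types 4 to 7, so their sum is absorbing unless the types are 4 and 5, which forces
    [x], [y], [z] into [X], [Y], [Z]. Sums have type 3, 6 or 7, and a product with a sum is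
    absorbing unless [x] has type 0 and the sum type 3, which again forces [Y] and [Z]. *)
Lemma distributes_outside n a x y z : small n a ->
  y < 8 * side n -> z < 8 * side n ->
  ~~ [&& x %/ side n == 0, y %/ side n == 1 & z %/ side n == 2] ->
  distributes n a x y z.
Proof.
move=> ha lty ltz h; rewrite /distributes.
rewrite [RHS in _ == RHS]plus_entry7 ?dot_entry_lt // ?dot_entry_type //.
- rewrite dot_entry7 ?plus_entry_lt // plus_entry_type //.
  case: eqP h => //= _; case: ifP => //= _ _; by case: ifP.
- by case: ifP => // /and3P[_]; case: (y %/ _) => [|[|[|[|]]]].
move: h; case: eqP => //= _.
case: (y %/ _) => [|[|[|[|y']]]] //=; case: (z %/ _) => [|[|[|[|z']]]] //=.
Qed.

Lemma distributes_inside n a x y z : small n a ->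
  x < side n -> y < side n -> z < side n ->
  distributes n a x (1 * side n + y) (2 * side n + z) =
    (padded n a x y + padded n a x z + padded n a y z == 3 * n + 3).
Proof.
move=> ha ltx lty ltz; rewrite /distributes.
have tx : x %/ side n = 0 by rewrite divn_small.
have vx : x %% side n = x by rewrite modn_small.
have -> : plus_entry n a (1 * side n + y) (2 * side n + z) =
    3 * side n + padded n a y z.
  by rewrite /plus_entry /types !divn_side // !modn_side.
have -> : dot_entry n a x (3 * side n + padded n a y z) =
    6 * side n + (3 * n + 3 + side n - padded n a y z) %% side n.
  by rewrite /dot_entry /types tx divn_side ?padded_lt // modn_side ?padded_lt.
have -> : dot_entry n a x (1 * side n + y) = 4 * side n + padded n a x y.
  by rewrite /dot_entry /types tx vx divn_side // modn_side.
have -> : dot_entry n a x (2 * side n + z) = 5 * side n + padded n a x z.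
  by rewrite /dot_entry /types tx vx divn_side // modn_side.
rewrite /plus_entry /types !divn_side ?padded_lt // !modn_side ?padded_lt //=.
rewrite eqn_add2l.
have := padded_le x y ha; have := padded_le x z ha; have := padded_le y z ha.
move: (padded n a y z) (padded n a x y) (padded n a x z) => d1 d2 d3 h1 h2 h3.
rewrite (@modn_small (_ + _)) /side; last by lia.
(* The only value above [3 * n + 3] is [d1 = 3 * n + 4]. Its residue is [9 * n + 12], out of reach
   for [d2 + d3 <= 6 * n + 8], so both equations fail. *)
have [le3|gt3] := leqP d1 (3 * n + 3).
  have -> : 3 * n + 3 + (9 * n + 13) - d1 = 3 * n + 3 - d1 + (9 * n + 13) by lia.
  by rewrite modnDr modn_small; lia.
by rewrite modn_small; lia.
Qed.

Definition zero_triples (n : nat) (a : nat -> nat) :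
    {set 'I_(side n) * 'I_(side n) * 'I_(side n)} :=
  [set t : 'I_(side n) * 'I_(side n) * 'I_(side n) |
    let: (x, y, z) := t in
    padded n a x y + padded n a x z + padded n a y z == 3 * n + 3].

Lemma shift_lt n t (v : 'I_(side n)) : t < 8 -> t * side n + v < 8 * side n.
Proof. by have := ltn_ord v; move: (nat_of_ord v) => u; nia. Qed.

Definition shift n t (lt8 : t < 8) (v : 'I_(side n)) : 'I_(8 * side n) :=
  Ordinal (shift_lt v lt8).

(** Of the [512 * L ^ 3] triples, the [L ^ 3] ones in [T], the image of [X * Y * Z], are
    distributive exactly when they are zero triples; all others always are. *)
Lemma card_distributive_triples n a (ha : small n a) :
  #|distributive_triples (reduction ha)| =
    511 * side n ^ 3 + #|zero_triples n a|.
Proof.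
pose f (t : 'I_(side n) * 'I_(side n) * 'I_(side n)) :=
  (@shift n 0 isT t.1.1, @shift n 1 isT t.1.2, @shift n 2 isT t.2).
have f_inj : injective f.
  move=> [[x y] z] [[x' y'] z'] [].
  by move=> /addnI/val_inj-> /addnI/val_inj-> /addnI/val_inj->.
have memD x y z : ((x, y, z) \in distributive_triples (reduction ha)) =
    distributes n a x y z by rewrite inE.
set D := distributive_triples _ in memD *.
set T := f @: [set: _]%SET.
have memT x y z : ((x, y, z) \in T) =
    [&& x %/ side n == 0, y %/ side n == 1 & z %/ side n == 2].
  apply/imsetP/and3P => [[[[u v] w] _ [-> -> ->]]|[/eqP x0 /eqP y1 /eqP z2]] /=.
    by rewrite !divn_side.
  have modP i : i %% side n < side n by rewrite ltn_pmod ?side_gt0.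
  exists (Ordinal (modP x), Ordinal (modP y), Ordinal (modP z)); rewrite ?inE //.
  congr (_, _, _); apply: val_inj => /=.
  - by rewrite [LHS](divn_eq _ (side n)) x0.
  - by rewrite [LHS](divn_eq _ (side n)) y1.
  - by rewrite [LHS](divn_eq _ (side n)) z2.
have cardT : #|T| = side n ^ 3.
  by rewrite card_imset // cardsT !card_prod !card_ord !expnS muln1 mulnA.
rewrite addnC -(cardsID T D); congr addn.
  rewrite -(card_imset _ f_inj); apply: eq_card => -[[x y] z].
  apply/setIP/imsetP => [[dD /imsetP[[[u v] w] _ E]]|[[[u v] w] h E]].
    exists (u, v, w) => //; move: dD; rewrite E memD inE.
    by rewrite -distributes_inside.
  split; last by rewrite E imset_f ?inE.
  by move: h; rewrite E memD inE -distributes_inside.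
have -> : D :\: T = ~: T.
  apply/setP => -[[x y] z]; rewrite finset.in_setD finset.in_setC.
  case: (boolP ((x, y, z) \in T)) => //= notT; rewrite memD.
  by apply: distributes_outside => //; rewrite -memT.
have := cardsC T; rewrite cardT !card_prod !card_ord.
by move: #|_| => X; rewrite !expnS expn0; nia.
Qed.

(** * Zero triangles in terms of the padded matrix *)

Lemma nth_allpairs (S T U : Type) (f : S -> T -> U) s t x0 y0 z0 i j :
  i < size s -> j < size t ->
  nth z0 (allpairs f s t) (i * size t + j) = f (nth x0 s i) (nth y0 t j).
Proof.
elim: s i => //= x s ih [|i] lti ltj; rewrite /= nth_cat size_map.
  by rewrite ltj (nth_map y0).
by rewrite mulSn -addnA ltnNge leq_addr /= addKn ih.
Qed.

Lemma nth_matrix (U : Type) n (f : 'I_n -> 'I_n -> U) z0 (u v : 'I_n) :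
  nth z0 [seq f x y | x <- enum 'I_n, y <- enum 'I_n] (u * n + v) = f u v.
Proof.
have := @nth_allpairs _ _ _ f (enum 'I_n) (enum 'I_n) u v z0 u v.
by rewrite size_enum_ord !nth_ord_enum => ->.
Qed.

(** This is the initial memory of a machine run on [G]. *)
Definition weights n (G : weighted_graph n) : nat -> nat :=
  nth 0 (n :: adjacency_matrix G).

Lemma weights_entry n (G : weighted_graph n) (u v : 'I_n) :
  weights G (u * n + v).+1 =
    if edge G u v then `|(weight G u v + n.+1%:Z)%R|%N else 0.
Proof. exact: nth_matrix. Qed.

Lemma weights_small n (G : weighted_graph n) : small n (weights G).
Proof.
case=> [|b]; rewrite /weights /=; first by lia.
have [ltb|leb] := ltnP b (size (adjacency_matrix G)); last first.
  by rewrite nth_default.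
have /allpairsP[[u v] /= [_ _ ->]] := mem_nth 0 ltb.
case: ifP => // /weight_bound; lia.
Qed.

Lemma padded_edge n (G : weighted_graph n) (u v : 'I_n) : edge G u v ->
  (padded n (weights G) u v)%:Z%R = (weight G u v + n.+1%:Z)%R.
Proof.
move=> euv; have := weight_bound euv.
rewrite /padded !ltn_ord weights_entry euv; case: ifP; lia.
Qed.

Lemma padded_edgeP n (G : weighted_graph n) u v :
  padded n (weights G) u v < 3 * n + 4 ->
  exists u' v' : 'I_n, [/\ u = u', v = v' & edge G u' v'].
Proof.
rewrite /padded; case: (ltnP u n) => [ltu|_]; last by rewrite ltnn.
case: (ltnP v n) => [ltv|_]; last by rewrite ltnn.
have /= -> := weights_entry G (Ordinal ltu) (Ordinal ltv).
case euv: (edge G _ _); last by rewrite !ltnn.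
by exists (Ordinal ltu), (Ordinal ltv).
Qed.

(** Natural numbers with sum [3 * n + 3] are all below [3 * n + 4], so the three pairs are edges;
    their shifts by [n + 1] then cancel against [3 * n + 3]. *)
Lemma zero_triples_weights n (G : weighted_graph n) :
  (0 < #|zero_triples n (weights G)|) = has_zero_triangle G.
Proof.
apply/card_gt0P/existsP=> [[[[x y] z]]|
    [u /existsP[v /existsP[x /and4P[e1 e2 e3]]]]].
  rewrite inE => /eqP h.
  have [|u [v [xu yv euv]]] := @padded_edgeP n G x y; first by lia.
  have [|u' [w [xu' zw euw]]] := @padded_edgeP n G x z; first by lia.
  have [|v' [w' [yv' zw' evw]]] := @padded_edgeP n G y z; first by lia.
  have E1 : u' = u by apply: val_inj; rewrite /= -xu'.
  have E2 : v' = v by apply: val_inj; rewrite /= -yv'.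
  have E3 : w' = w by apply: val_inj; rewrite /= -zw'.
  subst u' v' w'; exists u; apply/existsP; exists v; apply/existsP; exists w.
  rewrite euv evw euw; move: h; rewrite xu yv zw.
  have := padded_edge euv; have := padded_edge evw; have := padded_edge euw.
  lia.
have lt_side (i : 'I_n) : i < side n.
  by apply: ltn_trans (ltn_ord i) _; rewrite /side; lia.
move/eqP=> h.
exists (Ordinal (lt_side u), Ordinal (lt_side v), Ordinal (lt_side x)).
rewrite inE /=; apply/eqP.
have := padded_edge e1; have := padded_edge e2; have := padded_edge e3.
lia.
Qed.

(** * The program for zero triangle *)

Lemma eval_num w e m k : k < 2 ^ w -> eval w e m (Num k) = k.
Proof. exact: modn_small. Qed.

Lemma eval_var w e m x v : e x = v -> v < 2 ^ w -> eval w e m (Var x) = v.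
Proof. by move=> <-; apply: modn_small. Qed.

Lemma eval_add w e m a b x y : eval w e m a = x -> eval w e m b = y ->
  x + y < 2 ^ w -> eval w e m (Bin OAdd a b) = x + y.
Proof. by move=> /= -> ->; apply: modn_small. Qed.

Lemma eval_sub w e m a b x y : eval w e m a = x -> eval w e m b = y ->
  y <= x -> x < 2 ^ w -> eval w e m (Bin OSub a b) = x - y.
Proof.
move=> /= -> -> leyx ltx; rewrite /eval_binop addnC -addnBA // modnDl.
by rewrite modn_small //; lia.
Qed.

Lemma eval_mul w e m a b x y : eval w e m a = x -> eval w e m b = y ->
  x * y < 2 ^ w -> eval w e m (Bin OMul a b) = x * y.
Proof. by move=> /= -> ->; apply: modn_small. Qed.

Lemma eval_div w e m a b x y : eval w e m a = x -> eval w e m b = y ->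
  x < 2 ^ w -> eval w e m (Bin ODiv a b) = x %/ y.
Proof.
move=> /= -> -> ltx; apply: modn_small; exact: leq_ltn_trans (leq_div _ _) ltx.
Qed.

Lemma eval_mod w e m a b x y : eval w e m a = x -> eval w e m b = y ->
  x < 2 ^ w -> eval w e m (Bin OMod a b) = x %% y.
Proof.
move=> /= -> -> ltx; apply: modn_small; exact: leq_ltn_trans (leq_mod _ _) ltx.
Qed.

Lemma eval_shl w e m a b x y : eval w e m a = x -> eval w e m b = y ->
  x * 2 ^ y < 2 ^ w -> eval w e m (Bin OShl a b) = x * 2 ^ y.
Proof. by move=> /= -> ->; apply: modn_small. Qed.

(** Each branch has to be correct only under its own condition; thus the address in [padded_expr]
    needs a bound only for indices below [n]. *)
Lemma eval_if w e m lt a b s t x y p q : eval w e m a = x -> eval w e m b = y ->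
  (compare lt x y -> eval w e m s = p) ->
  (~~ compare lt x y -> eval w e m t = q) ->
  eval w e m (If lt a b s t) = if compare lt x y then p else q.
Proof. by move=> /= -> ->; case: compare => hp hq; [apply: hp|apply: hq]. Qed.

(* The variables of the program; 0 is the output and those from 8 on belong to
   the simulated program. *)
Notation nE := (Var 1).
Notation LE := (Var 2).
Notation NE := (Var 3).
Notation uE := (Var 4).
Notation ME := (Var size_var).
Notation kE := (Var 6).
Notation "a +e b" := (Bin OAdd a b) (at level 50, left associativity).
Notation "a -e b" := (Bin OSub a b) (at level 50, left associativity).
Notation "a *e b" := (Bin OMul a b) (at level 40, left associativity).
Notation "a /e b" := (Bin ODiv a b) (at level 40, left associativity).
Notation "a %e b" := (Bin OMod a b) (at level 40, left associativity).

(** * Expressions for the table entries *)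

Definition padded_expr (u v : expr) : expr :=
  let big := Num 3 *e nE +e Num 4 in
  let a := Deref (u *e nE +e v +e Num 1) in
  If true u nE (If true v nE (If true (Num 0) a a big) big) big.

Lemma eval_padded w e m n u v x y :
  eval w e m u = x -> eval w e m v = y -> e 1 = n ->
  n * n + 3 * n + 4 < 2 ^ w ->
  eval w e m (padded_expr u v) = padded n m x y.
Proof.
move=> eu ev e1 ltw.
have en : eval w e m nE = n by apply: eval_var e1 _; lia.
have ebig : eval w e m (Num 3 *e nE +e Num 4) = 3 * n + 4.
  apply: eval_add; [apply: eval_mul en _|apply: eval_num|]; try lia.
  by apply: eval_num; lia.
rewrite /padded -[x < n]/(compare true x n) -[y < n]/(compare true y n).
rewrite -[0 < _]/(compare true 0 _).
apply: eval_if => //; rewrite {1}/compare => ltx.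
apply: eval_if => //; rewrite {1}/compare => lty.
have ea : eval w e m (Deref (u *e nE +e v +e Num 1)) = m (x * n + y).+1.
  have lt : x * n + y < n * n by nia.
  rewrite -[LHS]/(m (eval w e m (u *e nE +e v +e Num 1))) -(addn1 (_ + y)).
  congr m.
  apply: eval_add; last by lia.
    by apply: eval_add => //; [apply: eval_mul => //; lia|lia].
  by apply: eval_num; lia.
by apply: eval_if => //; apply: eval_num; lia.
Qed.

Definition types_expr (i j : expr) : expr := (i /e LE) *e Num 8 +e (j /e LE).

Definition plus_expr (i j : expr) : expr :=
  If false (types_expr i j) (Num 10)
    (Num 3 *e LE +e padded_expr (i %e LE) (j %e LE))
  (If false (types_expr i j) (Num 37)
    (Num 6 *e LE +e (i %e LE +e j %e LE) %e LE)
    (Num 7 *e LE)).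

Definition dot_expr (i j : expr) : expr :=
  If false (types_expr i j) (Num 1)
    (Num 4 *e LE +e padded_expr (i %e LE) (j %e LE))
  (If false (types_expr i j) (Num 2)
    (Num 5 *e LE +e padded_expr (i %e LE) (j %e LE))
  (If false (types_expr i j) (Num 3)
    (Num 6 *e LE +e (Num 3 *e nE +e Num 3 +e LE -e j %e LE) %e LE)
    (Num 7 *e LE))).

Section Entries.
Variables (w n : nat) (e m a : nat -> nat) (iE jE : expr) (i j : nat).
Hypothesis a_small : small n a.
(** [a] stands for the initial memory and [m] for the current one, which may differ outside the
    matrix. *)
Hypothesis pad_a : padded n m =2 padded n a.
Hypothesis e1 : e 1 = n.
Hypothesis e2 : e 2 = side n.
Hypothesis ei : eval w e m iE = i.
Hypothesis ej : eval w e m jE = j.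
Hypothesis lti : i < 8 * side n.
Hypothesis ltj : j < 8 * side n.
Hypothesis ltw : (8 * side n) * (8 * side n) < 2 ^ w.

(** A single bound from which every overflow condition below follows. *)
Let bound : 100 * (n * n) + 100 * n + 8 * side n + 100 < 2 ^ w.
Proof. by move: ltw; rewrite /side; nia. Qed.

Let ltiw : i < 2 ^ w. Proof. by move: ltw lti; nia. Qed.
Let ltjw : j < 2 ^ w. Proof. by move: ltw ltj; nia. Qed.

Let eL : eval w e m LE = side n.
Proof. by apply: eval_var e2 _; move: bound; lia. Qed.

Let ltmod x : x %% side n < side n.
Proof. by rewrite ltn_pmod ?side_gt0. Qed.

Let eu : eval w e m (iE %e LE) = i %% side n. Proof. exact: eval_mod. Qed.
Let ev : eval w e m (jE %e LE) = j %% side n. Proof. exact: eval_mod. Qed.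

Let etypes : eval w e m (types_expr iE jE) = types n i j.
Proof.
have li : i %/ side n < 8 by rewrite ltn_divLR ?side_gt0.
have lj : j %/ side n < 8 by rewrite ltn_divLR ?side_gt0.
apply: eval_add; last by move: bound; lia.
  apply: eval_mul; [exact: eval_div|apply: eval_num|]; move: bound; lia.
exact: eval_div.
Qed.

Let eval_mulL k : k < 8 -> eval w e m (Num k *e LE) = k * side n.
Proof.
move=> ltk; apply: eval_mul eL _; last by move: bound; nia.
by apply: eval_num; move: bound; lia.
Qed.

Let eval_const k : k < 100 -> eval w e m (Num k) = k.
Proof. by move=> ltk; apply: eval_num; move: bound; lia. Qed.

Let epad : eval w e m (padded_expr (iE %e LE) (jE %e LE)) =
  padded n a (i %% side n) (j %% side n).
Proof. by rewrite -pad_a; apply: eval_padded => //; move: bound; nia. Qed.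

Lemma eval_plus :
  eval w e m (plus_expr iE jE) = plus_entry n a i j.
Proof.
have hp := padded_lt (i %% side n) (j %% side n) a_small.
rewrite /plus_entry -[_ == 10]/(compare false _ 10).
rewrite -[_ == 37]/(compare false _ 37); apply: eval_if => //; first exact: eval_const.
  move=> _; apply: eval_add => //; first exact: eval_mulL.
  by move: bound; lia.
move=> _; apply: eval_if => //; first exact: eval_const.
  have hu := ltmod i; have hv := ltmod j.
  have hs := ltmod (i %% side n + j %% side n).
  move=> _; apply: eval_add => //; first exact: eval_mulL.
    apply: eval_mod => //; last by move: bound; lia.
    by apply: eval_add => //; move: bound; lia.
  by move: bound; lia.
by move=> _; apply: eval_mulL.
Qed.

Lemma eval_dot :
  eval w e m (dot_expr iE jE) = dot_entry n a i j.
Proof.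
have hp := padded_lt (i %% side n) (j %% side n) a_small.
rewrite /dot_entry -[_ == 1]/(compare false _ 1) -[_ == 2]/(compare false _ 2).
rewrite -[_ == 3]/(compare false _ 3); apply: eval_if => //; first exact: eval_const.
  move=> _; apply: eval_add => //; first exact: eval_mulL.
  by move: bound; lia.
move=> _; apply: eval_if => //; first exact: eval_const.
  move=> _; apply: eval_add => //; first exact: eval_mulL.
  by move: bound; lia.
move=> _; apply: eval_if => //; first exact: eval_const.
  have hv := ltmod j; have hs := ltmod (3 * n + 3 + side n - j %% side n).
  move=> _; apply: eval_add => //; first exact: eval_mulL.
    apply: eval_mod => //; last by move: bound; lia.
    apply: eval_sub => //; [|lia|move: bound; lia].
    apply: eval_add => //; last by move: bound; lia.
    apply: eval_add; [|exact: eval_const|move: bound; lia].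
    apply: eval_mul; [exact: eval_const| |move: bound; lia].
    by apply: eval_var e1 _; move: bound; lia.
  by move: bound; lia.
by move=> _; apply: eval_mulL.
Qed.
End Entries.

(* The memory after [k] entries of each table, with the encoding of the tables
   starting at the address [M]. *)
Definition layout (M N : nat) (a : nat -> nat) (f g : nat -> nat) (k b : nat)
    : nat :=
  if b < M then a b
  else if b == M then N
  else let l := b - M.+1 in
    if l < k then f l
    else if N * N <= l < N * N + k then g (l - N * N)
    else 0.

Lemma layout0 M N a f g : (forall b, M <= b -> a b = 0) ->
  [eta a with M |-> N] = layout M N a f g 0 :> (nat -> nat).
Proof.
move=> ha; apply/funext => b; rewrite /layout /=; case: ltngtP => // hb.
by rewrite ifF; [exact: ha (ltnW hb)|lia].
Qed.

Lemma layoutS M N a f g k : k < N * N ->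
  [eta [eta layout M N a f g k with M + (k + 1) |-> f k]
     with M + (N * N + (k + 1)) |-> g k] =
  layout M N a f g k.+1 :> (nat -> nat).
Proof.
move=> ltk; apply/funext => b; rewrite /layout /=.
case: (ltngtP b M) => hb; last by rewrite !ifF //; lia.
  by rewrite !ifF //; lia.
case: eqP => [->|ne1].
  rewrite ifF; last by lia.
  rewrite ifT; last by lia.
  by congr g; lia.
case: eqP => [->|ne2].
  by rewrite ifT; [congr f; lia|lia].
have -> : (b - M.+1 < k.+1) = (b - M.+1 < k) by lia.
case: ifP => // _.
have -> // : (N * N <= b - M.+1 < N * N + k.+1) =
    (N * N <= b - M.+1 < N * N + k) by lia.
Qed.

Lemma nth_cayley_table n (op : 'I_n -> 'I_n -> 'I_n) b (i j : 'I_n) :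
  b = i * n + j -> nth 0 (cayley_table op) b = op i j.
Proof. by move=> ->; rewrite (nth_matrix (fun x y => val (op x y))). Qed.

Lemma size_cayley_table n (op : 'I_n -> 'I_n -> 'I_n) :
  size (cayley_table op) = n * n.
Proof. by rewrite size_allpairs size_enum_ord. Qed.

(** Behind the tables both sides are 0, so the memory from [M] on looks like an initial memory of
    the simulated program. *)
Lemma layout_encode M n (S : two_ops n) a (f g : nat -> nat) :
  (forall i j : 'I_n, f (i * n + j) = oplus S i j :> nat) ->
  (forall i j : 'I_n, g (i * n + j) = odot S i j :> nat) ->
  forall b, layout M n a f g (n * n) (M + b) =
    nth 0 (encode (p := counting_distributive_triples) S) b.
Proof.
move=> hf hg b; rewrite /layout ltnNge leq_addr /=.
case: b => [|b]; first by rewrite addn0 eqxx.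
rewrite ifF; last by lia.
have -> : M + b.+1 - M.+1 = b by lia.
rewrite /= nth_cat size_cayley_table.
have key (op : 'I_n -> 'I_n -> 'I_n) (h : nat -> nat) c :
    (forall i j : 'I_n, h (i * n + j) = op i j :> nat) -> c < n * n ->
    h c = nth 0 (cayley_table op) c.
  move=> hh ltc; have n_gt0 : 0 < n by case: (n) ltc.
  have lti : c %/ n < n by rewrite ltn_divLR.
  have ltj : c %% n < n by rewrite ltn_pmod.
  have cE := divn_eq c n.
  by rewrite (nth_cayley_table _ (i := Ordinal lti) (j := Ordinal ltj)) //
    {1}cE -hh.
case: ltnP => [ltb|leb]; first exact: key.
case: ltnP => [ltb|leb'] /=; first by apply: key => //; lia.
by rewrite nth_default // size_cayley_table; lia.
Qed.

(** The default 0 covers the registers of the simulated program, which have to start at 0. *)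
Definition regs (n u M k : nat) : nat -> nat :=
  nth 0 [:: 0; n; side n; 8 * side n; u; M; k].

(** Brings a variable not yet assigned, such as a loop counter, into the list with its initial value
    0. *)
Lemma nth_rcons0 (s : seq nat) : nth 0 (rcons s 0) = nth 0 s.
Proof.
apply/funext => i; rewrite nth_rcons; case: ltngtP => // [lt|->].
  by rewrite nth_default // ltnW.
by rewrite nth_default.
Qed.

Lemma runs_assign_nth w s m x v y s' :
  eval w (nth 0 s) m x = y -> y < 2 ^ w -> set_nth 0 s v y = s' ->
  runs w (assign v x) (cost x + 1) (nth 0 s) m (nth 0 s') m.
Proof.
move=> ex lty <-; have := runs_assign v ex lty; congr runs.
by apply/funext => z; rewrite nth_set_nth.
Qed.

(* The loop sets [u] to [up_log 2 N.+2], so that [M] becomes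
   [2 ^ word_length c N]. *)
Definition setup (c : nat) : code :=
  assign 1 (Deref (Num 0)) ;;
  assign 2 (Num 9 *e nE +e Num 13) ;;
  assign 3 (Num 8 *e LE) ;;
  while_lt (Bin OShl (Num 1) uE) (NE +e Num 2) (assign 4 (uE +e Num 1)) ;;
  assign size_var (Bin OShl (Num 1) (Num c *e uE)) ;;
  store ME NE.

(** Cell [M] already holds [N], hence the offset 1; [k] is the row-major index into both tables at
    once. *)
Definition fill : code :=
  while_lt kE (NE *e NE)
    (store (ME +e (kE +e Num 1)) (plus_expr (kE /e NE) (kE %e NE)) ;;
     store (ME +e (NE *e NE +e (kE +e Num 1)))
       (dot_expr (kE /e NE) (kE %e NE)) ;;
     assign 6 (kE +e Num 1)).

(** [Var 8] is register 0 of the simulated program, which holds its output. *)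
Definition verdict : code :=
  assign 0 (If false (Var 8) (Num 511 *e LE *e LE *e LE) (Num 0) (Num 1)).

(** * Effect and running time of the preparation *)

Section Prelude.
Variables (c w n : nat) (a : nat -> nat).
Hypothesis a_small : small n a.
Let N := 8 * side n.
Let v := word_length c N.
Let M := 2 ^ v.
Hypothesis ltM : 2 * (N * N) < M.
Hypothesis ltv : v < w.

Let N_ge : 100 <= N. Proof. by rewrite /N /side; lia. Qed.
Let n_le : 72 * n <= N. Proof. by rewrite /N /side; lia. Qed.
Let ltNN : N < N * N. Proof. by nia. Qed.
Let ltw : 2 * M <= 2 ^ w. Proof. by rewrite /M -expnS leq_exp2l. Qed.

Lemma runs_setup : a 0 = n ->
  runs w (setup c) (100 * (N * N)) (fun=> 0) a
    (regs n (up_log 2 N.+2) M 0) [eta a with M |-> N].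
Proof.
move=> a0; have c_gt0 : 0 < c.
  rewrite lt0n; apply/eqP => c0; have M1 : M = 1 by rewrite /M /v /word_length c0.
  by move: ltM; rewrite M1; lia.
set U := up_log 2 N.+2.
have leU : 2 ^ U <= M by rewrite /M leq_exp2l // /v /word_length -/U leq_pmull.
(* From [U - 1 < 2 ^ (U - 1) < N + 2]: the loop has at most linearly many rounds. *)
have UN : U <= N.+2.
  have := @up_log_gtn 2 N.+2 isT isT; rewrite -/U.
  by have := @ltn_expl 2 U.-1 isT; lia.
have ltcv : c <= v by rewrite /v /word_length leq_pmulr // up_log_gt0.
have ltvM : v < M by apply: ltn_expl.
have eN k t m : eval w (nth 0 [:: 0, n, side n, N, k & t]) m NE = N.
  by apply: eval_var => //; lia.
have eu k t m : k < M -> eval w (nth 0 [:: 0, n, side n, N, k & t]) m uE = k.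
  by move=> ltk; apply: eval_var => //; lia.
have -> : (fun=> 0) = nth 0 [::] by apply/funext => x; rewrite nth_nil.
have h1 : runs w (assign 1 (Deref (Num 0))) 3 (nth 0 [::]) a (nth 0 [:: 0; n]) a.
  apply: (@runs_assign_nth _ _ _ (Deref (Num 0)) _ n) => //=; last by lia.
  by rewrite mod0n.
have h2 : runs w (assign 2 (Num 9 *e nE +e Num 13)) 6 (nth 0 [:: 0; n]) a
    (nth 0 [:: 0; n; side n]) a.
  apply: (@runs_assign_nth _ _ _ (Num 9 *e nE +e Num 13) _ (side n)) => //.
    apply: eval_add; [apply: eval_mul|apply: eval_num|]; try lia.
      by apply: eval_num; lia.
    by apply: eval_var; [|lia].
  by have : side n <= N; [rewrite /N leq_pmull|lia].
have h3 : runs w (assign 3 (Num 8 *e LE)) 4 (nth 0 [:: 0; n; side n]) a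
    (nth 0 [:: 0; n; side n; N]) a.
  have leN : side n <= N by rewrite /N leq_pmull.
  apply: (@runs_assign_nth _ _ _ (Num 8 *e LE) _ N) => //; last by lia.
  apply: eval_mul; [apply: eval_num; lia|apply: eval_var => //; lia|].
  by rewrite -/N; lia.
have h4 : runs w (while_lt (Bin OShl (Num 1) uE) (NE +e Num 2)
      (assign 4 (uE +e Num 1))) (U * 12 + 8)
    (nth 0 [:: 0; n; side n; N]) a (nth 0 [:: 0; n; side n; N; U]) a.
  rewrite -(nth_rcons0 [:: 0; n; side n; N]) /=.
  have eS k m : k <= U -> eval w (nth 0 [:: 0; n; side n; N; k]) m
      (Bin OShl (Num 1) uE) = 2 ^ k.
    move=> lek; have le2 : 2 ^ k <= 2 ^ U by rewrite leq_exp2l.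
    have ltk := @ltn_expl 2 k isT.
    rewrite -[RHS]mul1n; apply: eval_shl; [apply: eval_num; lia|apply: eu; lia|].
    by rewrite mul1n; lia.
  have eN2 k m : eval w (nth 0 [:: 0; n; side n; N; k]) m (NE +e Num 2) = N.+2.
    by rewrite -(addn2 N); apply: eval_add => //; [apply: eval_num|]; lia.
  apply: (@runs_while w _ _ _ 4 U (fun k => nth 0 [:: 0; n; side n; N; k])
    (fun=> a)) => [k ltk||k ltk]; cbv beta.
  - rewrite eS ?eN2; last by apply: ltnW.
    rewrite ltnNge; apply: contraL ltk => /(@up_log_min 2 _ _ isT).
    by rewrite -leqNgt.
  - by rewrite eS // eN2 up_logP.
  - have ltk2 := @ltn_expl 2 U isT.
    apply: (@runs_assign_nth _ _ _ (uE +e Num 1) _ k.+1) => //; last by lia.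
    rewrite -(addn1 k).
    by apply: eval_add; [apply: eu; lia|apply: eval_num; lia|lia].
have h5 : runs w (assign size_var (Bin OShl (Num 1) (Num c *e uE))) 6
    (nth 0 [:: 0; n; side n; N; U]) a (nth 0 [:: 0; n; side n; N; U; M]) a.
  apply: (@runs_assign_nth _ _ _ (Bin OShl (Num 1) (Num c *e uE)) _ M) => //;
    last by lia.
  have ltk2 := @ltn_expl 2 U isT.
  have cU : c * U = v by [].
  rewrite -[M]mul1n -[M]/(2 ^ (c * U)); apply: eval_shl; [apply: eval_num; lia| |].
    by apply: eval_mul; [apply: eval_num; lia|apply: eu; lia|rewrite cU; lia].
  by rewrite cU -/M; lia.
have h6 : runs w (store ME NE) 3 (nth 0 [:: 0; n; side n; N; U; M]) a
    (regs n U M 0) [eta a with M |-> N].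
  rewrite /regs -(nth_rcons0 [:: 0; n; side n; N; U; M]) /=.
  by apply: (@runs_store _ ME NE) => //; apply: eval_var => //; lia.
have := runs_seqc h1 (runs_seqc h2 (runs_seqc h3 (runs_seqc h4 (runs_seqc h5 h6)))).
by apply: runs_leq; lia.
Qed.

Let f k := plus_entry n a (k %/ N) (k %% N).
Let g k := dot_entry n a (k %/ N) (k %% N).

Lemma runs_fill u : u < 2 ^ w ->
  runs w fill (1000 * (N * N)) (regs n u M 0) (layout M N a f g 0)
    (regs n u M (N * N)) (layout M N a f g (N * N)).
Proof.
move=> ltu.
have eK k m : k <= N * N -> eval w (regs n u M k) m kE = k.
  by move=> lek; apply: eval_var => //; lia.
have eN k m : eval w (regs n u M k) m NE = N by apply: eval_var => //; lia.
have eM k m : eval w (regs n u M k) m ME = M by apply: eval_var => //; lia.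
have eNN k m : eval w (regs n u M k) m (NE *e NE) = N * N.
  by apply: eval_mul => //; lia.
have eK1 k m : k < N * N -> eval w (regs n u M k) m (kE +e Num 1) = k + 1.
  by move=> ltk; apply: eval_add; [apply: eK; lia|apply: eval_num; lia|lia].
apply: runs_leq; last first.
  apply: (@runs_while w kE (NE *e NE) _ _ (N * N) (regs n u M)
    (layout M N a f g)) => [k ltk||k ltk].
  - by rewrite eNN eK // ltnW.
  - by rewrite eNN eK.
  - rewrite -layoutS //.
    have N_gt0 : 0 < N by lia.
    have lti : k %/ N < N by rewrite ltn_divLR.
    have ltj : k %% N < N by rewrite ltn_pmod.
    have ei m : eval w (regs n u M k) m (kE /e NE) = k %/ N.
      by apply: eval_div; [apply: eK; lia|apply: eN|lia].
    have ej m : eval w (regs n u M k) m (kE %e NE) = k %% N.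
      by apply: eval_mod; [apply: eK; lia|apply: eN|lia].
    (* The matrix occupies addresses up to [n * n < M], below everything that is written. *)
    have padE m : (forall b, b < M -> m b = a b) -> padded n m =2 padded n a.
      move=> hm x y; rewrite /padded; case: ltnP => // ltx; case: ltnP => // lty.
      have le1 : (x * n + y).+1 <= n * n by nia.
      have le2 : n * n <= N * N by nia.
      by rewrite hm //; lia.
    have layE b : b < M -> layout M N a f g k b = a b.
      by move=> ltb; rewrite /layout ltb.
    have fE m : (forall b, b < M -> m b = a b) ->
        eval w (regs n u M k) m (plus_expr (kE /e NE) (kE %e NE)) = f k.
      by move=> hm; apply: eval_plus => //; [exact: padE|rewrite -/N; lia].
    have gE m : (forall b, b < M -> m b = a b) ->
        eval w (regs n u M k) m (dot_expr (kE /e NE) (kE %e NE)) = g k.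
      by move=> hm; apply: eval_dot => //; [exact: padE|rewrite -/N; lia].
    (* The second entry is computed when the first one is already in memory. *)
    have lay'E b : b < M ->
        [eta layout M N a f g k with M + (k + 1) |-> f k] b = a b.
      by move=> ltb; rewrite /= ifF ?layE //; apply/eqP; lia.
    apply: runs_seqc; [apply: runs_store|apply: runs_seqc;
      [apply: runs_store|apply: (@runs_assign_nth _ _ _ (kE +e Num 1) _ k.+1)]].
    + by apply: eval_add; [apply: eM|apply: eK1|lia].
    + exact: fE.
    + apply: eval_add; [apply: eM| |lia].
      by apply: eval_add; [apply: eNN|apply: eK1|lia].
    + exact: gE.
    + by rewrite -(addn1 k); apply: eK1.
    + by lia.
    + by [].
by rewrite /=; lia.
Qed.
End Prelude.

(** * Correctness of the whole program *)

Lemma computes_reaches w p input t s out :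
  reaches w p t (init input) s -> current p s = Halt -> reg s 0 = out ->
  computes_within w p input t out.
Proof.
move=> [t' let' hs] halted outE; rewrite /computes_within.
by rewrite -(subnK let') iterD hs iter_step_halted.
Qed.

(** An output is a word of the machine, so the correctness of [p] by itself bounds the count by
    [2 ^ v]. *)
Lemma computes_within_bounded w p input t out :
  fits w input -> computes_within w p input t out -> out < 2 ^ w.
Proof.
move=> /bounded_init h [_ <-]; set s := iter _ _ _.
suff [] : bounded w s by [].
by rewrite /s; elim: t {s} => //= t; apply: bounded_step.
Qed.

Definition solver (c : nat) (p : program) : program :=
  ((setup c ;; fill) ;; simulate p ;; verdict) 0.

(** From [72 * n + 106 <= 2 ^ 7 * (n + 2)] the logarithm grows by at most 7, hence at most eightfold
    as it is positive; the successor in [(8 * c).+1] makes the inequality strict. *)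
Lemma word_length_reduction c n :
  word_length c (8 * side n) < word_length (8 * c).+1 n.
Proof.
rewrite /word_length; set u := up_log 2 n.+2.
have u_gt0 : 0 < u by rewrite up_log_gt0.
suff : up_log 2 (8 * side n).+2 <= 8 * u by nia.
apply: up_log_min => //; have := @up_logP 2 n.+2 isT; rewrite -/u => le2.
apply: (@leq_trans (2 ^ 7 * 2 ^ u)); last by rewrite -expnD leq_exp2l //; lia.
apply: (@leq_trans (2 ^ 7 * n.+2)); last by rewrite leq_mul2l le2 orbT.
by rewrite /side; lia.
Qed.

Lemma regs_out n u M k x : regs n u M k (x + 8) = 0.
Proof. by rewrite addnC. Qed.

Lemma divn_modn_ord N (op : nat -> nat -> nat) (i j : 'I_N) :
  op ((i * N + j) %/ N) ((i * N + j) %% N) = op i j.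
Proof.
have N_gt0 : 0 < N by apply: leq_ltn_trans (ltn_ord i).
by rewrite divnMDl // divn_small // addn0 modnMDl modn_small.
Qed.

Lemma runs_verdict w e m L k :
  e 2 = L -> e 8 = k -> 0 < L -> 511 * L ^ 3 < 2 ^ w -> k < 2 ^ w ->
  runs w verdict 13 e m [eta e with 0 |-> nat_of_bool (k != 511 * L ^ 3)] m.
Proof.
move=> e2 e8 L_gt0; have [X XE] : {X | X = 511 * L ^ 3} by exists (511 * L ^ 3).
rewrite -XE => ltX ltk.
have {}XE : X = 511 * L * L * L by rewrite XE !expnS expn0 muln1 !mulnA.
have lt3 : 511 * L * L * L < 2 ^ w by rewrite -XE.
have lt2 : 511 * L * L < 2 ^ w := leq_ltn_trans (leq_pmulr _ L_gt0) lt3.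
have lt1 : 511 * L < 2 ^ w := leq_ltn_trans (leq_pmulr _ L_gt0) lt2.
have lt0 : 511 < 2 ^ w := leq_ltn_trans (leq_pmulr _ L_gt0) lt1.
have evL : eval w e m LE = L by apply: eval_var => //; lia.
have evX : eval w e m (Num 511 *e LE *e LE *e LE) = X.
  rewrite XE; apply: (eval_mul _ evL lt3); apply: (eval_mul _ evL lt2).
  by apply: (eval_mul _ evL lt1); apply: eval_num.
apply: (@runs_assign w 0 (If false (Var 8) (Num 511 *e LE *e LE *e LE)
  (Num 0) (Num 1))); last by case: eqP; lia.
have -> : nat_of_bool (k != X) = if compare false k X then 0 else 1.
  by rewrite /compare; case: eqP.
apply: eval_if evX _ _ => [|_|_]; first exact: eval_var.
  by apply: eval_num; lia.
by apply: eval_num; lia.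
Qed.

(** With [N = 8 * side n], setup and tables take at most [1100 * N ^ 2] steps; the remaining
    [100 * N ^ 2] absorb the 13 steps of the verdict and the one that leaves the simulation. *)
Lemma solver_correct c p T :
  solves_in_time counting_distributive_triples c p T ->
  solves_in_time zero_triangle (8 * c).+1 (solver c p)
    (fun n => 1200 * (8 * side n * (8 * side n)) + 3 * T (8 * side n)).
Proof.
move=> hp n G; set a := weights G; have ha : small n a := weights_small G.
set w := word_length _ n.
have [] := hp _ (reduction ha); set v := word_length c _ => fit comp.
have ltvw : v < w := word_length_reduction c n.
set N := 8 * side n; set M := 2 ^ v.
(* The encoding of the tables has [2 * (N * N) + 1] words and fits into [2 ^ v] cells; hence [M]
   also lies behind the encoding of the graph. *)
have ltM : 2 * (N * N) < M.
  by case: fit; rewrite /= size_cat !size_cayley_table -/N -/M; lia.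
have leNn : 72 * n + 100 <= N by rewrite /N /side; lia.
have leNN : N <= N * N by rewrite leq_pmulr //; lia.
have ltMw : 2 * M <= 2 ^ w by rewrite /M -expnS leq_exp2l.
have sizeG : size (encode (p := zero_triangle) G) = (n * n).+1.
  by rewrite /= size_allpairs size_enum_ord.
have lenN : n * n <= N * N by rewrite leq_mul //; lia.
have leMn : (n * n).+1 <= M by lia.
have a_out b : M <= b -> a b = 0.
  by move=> leb; rewrite /a /weights nth_default // sizeG; lia.
split.
  split; first by rewrite sizeG; lia.
  move=> x /(nthP 0) [b _ <-].
  have := ha b; rewrite -[nth _ _ _]/(a b); lia.
have count_lt := computes_within_bounded fit comp.
rewrite [answer _]/= in comp count_lt; set count := #|_| in comp count_lt.
have a0 : a 0 = n by [].
have h1 := @runs_setup c w n a ltM ltvw a0.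
have h2 := @runs_fill c w n a ha ltM ltvw (up_log 2 N.+2).
rewrite -layout0 // in h2.
have ltu : up_log 2 N.+2 < 2 ^ w.
  have := @up_log_gtn 2 N.+2 isT isT.
  have := @ltn_expl 2 (up_log 2 N.+2).-1 isT; lia.
have {h1 h2} h := runs_seqc h1 (h2 ltu).
have [//|r1 he g1] := h (fun=> 0).
rewrite -/N -/v -/M in he g1.
set m1 := layout _ _ _ _ _ _ in g1.
set pre := (setup c ;; fill) 0.
set sim := simulate p (size pre).
set post := verdict (size pre + size sim).
have solverE : solver c p = pre ++ sim ++ post by rewrite /solver /seqc.
have mE b : b < M -> m1 (M + b) =
    nth 0 (encode (p := counting_distributive_triples) (reduction ha)) b.
  move=> _; exact: (@layout_encode M N (reduction ha) a _ _
    (divn_modn_ord (plus_entry n a)) (divn_modn_ord (dot_entry n a)) b).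
have szE x : r1 (own x) = 0 := etrans (he _) (regs_out _ _ _ _ _).
have [r2 [m2 [outE keepE g2]]] := @reaches_simulate w v p _ _ _ pre post r1 m1
  ltvw fit comp (he _) szE mE.
set L := side n.
have e8 : r2 (var 8) = count by [].
have eL : r2 (var 2) = L by rewrite keepE // he.
(* The threshold is at most the count, an output word of [p], and so does not overflow. *)
have leX : 511 * L ^ 3 <= count.
  by rewrite /count card_distributive_triples leq_addr.
have zE : (count == 511 * L ^ 3) = ~~ has_zero_triangle G.
  rewrite -zero_triples_weights /count card_distributive_triples.
  by rewrite -[X in _ == X]addn0 eqn_add2l lt0n negbK.
have lt2 : 2 ^ v < 2 ^ w by rewrite ltn_exp2l.
pose e x := r2 (var x).
have hv := @runs_verdict w e m2 L count eL e8 (side_gt0 n)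
  (leq_ltn_trans leX (ltn_trans count_lt lt2)) (ltn_trans count_lt lt2).
rewrite zE negbK in hv.
have [//|r3 he3 g3] := hv r2.
rewrite /= in he3.
have {}g1 := g1 [::] (sim ++ post).
have {}g3 := g3 (pre ++ sim) [::].
rewrite size_cat -/post cats0 -catA in g3.
rewrite -/sim in g2.
have g : reaches w (pre ++ sim ++ post)
    (100 * (N * N) + 1000 * (N * N) + ((3 * T N).+1 + 13))
    (init (encode (p := zero_triangle) G))
    (State (size pre + size sim + size post) r3 m2).
  exact: reaches_trans g1 (reaches_trans g2 g3).
have {}g : reaches w (solver c p) (1200 * (N * N) + 3 * T N)
    (init (encode (p := zero_triangle) G))
    (State (size pre + size sim + size post) r3 m2).
  by rewrite solverE; apply: reaches_leq g; lia.
apply: (computes_reaches g); last exact: (he3 0).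
(* The run ends just behind the last instruction, where the default [Halt] applies. *)
rewrite /current solverE; apply: nth_default.
by rewrite (size_cat pre) (size_cat sim) addnA; exact: leqnn.
Qed.

(** * Running time *)

Import Order.TTheory GRing.Theory Num.Theory.
Local Open Scope classical_set_scope.
Local Open Scope ring_scope.

Lemma bigO_natP (R : realType) (T : nat -> nat) (x : R) :
  ((fun n => (T n)%:R : R) =O_\oo (fun n => n%:R `^ x)) <->
  exists (C : R) (n0 : nat), 0 < C /\
    forall n, (n0 <= n)%N -> (T n)%:R <= C * n%:R `^ x.
Proof.
split.
  move=> /eqO_exP[C C_gt0 [n0 _ h]]; exists C, n0; split=> // n len.
  by have := h n len; rewrite /= normr_nat ger0_norm ?powR_ge0.
move=> [C [n0 [C_gt0 h]]]; apply/eqO_exP; exists C => //; exists n0 => // n len.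
by rewrite /= normr_nat ger0_norm ?powR_ge0 ?h.
Qed.

(** Writing the tables takes quadratic time, so the exponent must not drop below 2; replacing [eps]
    by its minimum with 1 ensures this. *)
Lemma bigO_reduction (R : realType) (T : nat -> nat) (eps : R) :
  0 < eps ->
  ((fun n => (T n)%:R : R) =O_\oo (fun n => n%:R `^ (3 - eps))) ->
  ((fun n => (1200 * (8 * side n * (8 * side n)) + 3 * T (8 * side n))%:R : R)
     =O_\oo (fun n => n%:R `^ (3 - Num.min eps 1))).
Proof.
move=> eps_gt0 /bigO_natP[C [n0 [C_gt0 h]]]; apply/bigO_natP.
set d := 3 - Num.min eps 1.
have d2 : 2 <= d.
  rewrite /d; have : Num.min eps 1 <= 1 by rewrite ge_min lexx orbT.
  by lra.
have led : 3 - eps <= d by rewrite lerD2l lerN2 ge_min lexx.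
(* For [n >= 1] the number of elements [72 * n + 104] is at most [176 * n]. *)
exists (1200 * 176 `^ d + 3 * (C * 176 `^ d)), (maxn n0 1).
split.
  by apply: addr_gt0; rewrite ?mulr_gt0 ?powR_gt0 ?ltr0n.
move=> n; rewrite geq_max => /andP[len0 n_gt0].
set N := (8 * side n)%N.
have N_ge1 : (1 : R) <= N%:R by rewrite ler1n /N /side; lia.
have leN : N%:R `^ d <= 176 `^ d * n%:R `^ d.
  rewrite -powRM // ge0_ler_powR ?nnegrE ?mulr_ge0 //; first by lra.
  by rewrite -natrM ler_nat /N /side; lia.
rewrite natrD (natrM R 1200) (natrM R N) (natrM R 3).
rewrite [leRHS]mulrDl -[1200 * _ * _]mulrA -[3 * (_ * _) * _]mulrA.
rewrite -[C * _ * _]mulrA.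
rewrite lerD // ler_pM2l ?ltr0n //; last first.
  have := h N; rewrite /N /side => /(_ _)/le_trans; apply; first by lia.
  rewrite ler_pM2l //; apply: le_trans leN; exact: ler_powR.
apply: le_trans leN.
have -> : N%:R * N%:R = N%:R `^ 2 :> R by rewrite -expr2 powR_mulrn.
exact: ler_powR.
Qed.

Theorem theorem1p7 (R : realType) (eps : R) (eps_gt0 : 0 < eps)
  (alg : solvable_in_time_O counting_distributive_triples
           (fun n : nat => n%:R `^ (3 - eps))) :
  ~ strong_zero_triangle_hypothesis R.
Proof.
case: alg => c [p [T [correct fast]]] szth.
have min_gt0 : 0 < Num.min eps 1 by rewrite lt_min eps_gt0 ltr01.
apply: (szth _ min_gt0); do 3!eexists; split; first exact: solver_correct correct.
exact: bigO_reduction.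
Qed.
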